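(* For any tenable balanced $2\times2$ urn with subtraction, the random variable $X_n$ representing the number of balls of the first color at time $n$ is asymptotically Gaussian with speed of convergence to the limit $O(n^{-1/2})$: as $n\to\infty$, uniformly in $x\in\mathbb{R}$, $$\mathbb{P}\left(\frac{X_n-\mathbb{E}(X_n)}{\sqrt{\mathbb{V}(X_n)}}\le x\right)=\frac1{\sqrt{2\pi}}\int_{-\infty}^xe^{-y^2/2}\,dy+O\!\left(\frac1{\sqrt n}\right).$$
   Context: A balanced $2\times2$ urn with subtraction has matrix $\begin{pmatrix}-a&a+s\\ b+s&-b\end{pmatrix}$ with $a,b,s$ positive integers and starts with $a_0$ balls of the first color and $b_0$ of the second, $a_0+b_0\ge1$. At each time step a ball is drawn uniformly at random, observed and put back; if it is of the first color, $a$ balls of the first color are removed and $a+s$ of the second are added; if it is of the second color, $b+s$ balls of the first color are added and $b$ of the second are removed. Tenability: $a\mid a_0$, $b\mid b_0$, $a\mid b+s$, $b\mid a+s$. $\mathbb{E}$ and $\mathbb{V}$ denote expectation and variance. *)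

(* Defs.v *)
From HB Require Import structures.
From mathcomp Require Import all_boot all_order all_algebra.
From mathcomp Require Import all_classical all_reals all_analysis.

Set Implicit Arguments.
Unset Strict Implicit.
Unset Printing Implicit Defensive.

Import Order.TTheory GRing.Theory Num.Theory.
Import numFieldNormedType.Exports.

Local Open Scope classical_set_scope.
Local Open Scope ring_scope.

(* An urn composition is a pair (balls of the first color, balls of the second
   color).  The counts are integers, so that subtraction is not truncated; for
   a tenable urn they never become negative.  A color is a boolean, true being
   the first color. *)
Definition urn_step (a b s : nat) (z : int * int) (c : bool) : int * int :=
  if c then (z.1 - a%:Z, z.2 + (a + s)%:Z)
  else (z.1 + (b + s)%:Z, z.2 - b%:Z).

(* The list h of drawn colors is in chronological order. *)
Definition urn_after (a b s a0 b0 : nat) (h : seq bool) : int * int :=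
  foldl (urn_step a b s) (a0%:Z, b0%:Z) h.

Definition tenable (a b s a0 b0 : nat) : bool :=
  [&& a %| a0, b %| b0, a %| b + s & b %| a + s]%N.

Definition past_draws (T : Type) (D : nat -> T -> bool) (n : nat) (w : T) :
  seq bool := mkseq (fun i => D i w) n.

(* D n is the color drawn between times n and n + 1.  Given the colors h of the
   first n draws, the first color is drawn with probability the proportion of
   balls of that color; the chain rule is written as a product, so that histories
   of probability 0 need no convention.  The rule for the second color follows
   by taking complements. *)
Definition urn_draws d (T : measurableType d) (R : realType)
    (P : probability T R) (a b s a0 b0 : nat) (D : nat -> {RV P >-> bool}) :
    Prop :=
  forall (n : nat) (h : seq bool),
    P [set w | past_draws D n w = h /\ D n w = true] =
    (P [set w | past_draws D n w = h] *
      (let z := urn_after a b s a0 b0 h in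
       z.1%:~R / (z.1 + z.2)%:~R)%:E)%E.

Definition first_color (T : Type) (R : realType) (a b s a0 b0 : nat)
    (D : nat -> T -> bool) (n : nat) (w : T) : R :=
  (urn_after a b s a0 b0 (past_draws D n w)).1%:~R.

(* Main.v *)
Require Import Defs.
From HB Require Import structures.
From mathcomp Require Import all_boot all_order all_algebra.
From mathcomp Require Import all_classical all_reals all_analysis.
From mathcomp Require Import complex.
From mathcomp Require Import zify ring lra.
Set Implicit Arguments.
Unset Strict Implicit.
Unset Printing Implicit Defensive.
Import Order.TTheory GRing.Theory Num.Theory.
Import numFieldNormedType.Exports.
Local Open Scope classical_set_scope.
Local Open Scope ring_scope.

(** Put sg = a + b + s, and let C_n be the number of draws of the second color
among the first n.  Then X_n = a0 - a n + sg C_n, so X_n and C_n have the same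
standardization, and the theorem is a Berry-Esseen bound for C_n.  It rests on
three facts.

First, C_n is distributed as a sum of independent Bernoulli variables
(count_law_poisson_binomial).  Its generating polynomials obey
f_(n+1) = (c + (1 - c) v) f_n + be v (1 - v) f_n' with be > 0 (urn_op), and this
operator preserves real-rootedness.  Indeed, if f is the product of the factors
1 - p_j + p_j v and if v is not real, then the image of f divided by v f(v) is
    c / v + (1 - c) + be * sum_j (1 / (1 - p_j + p_j v) - 1).
The terms with p_j = 1 are equal to 1 / v - 1; let m be their number.  The total
coefficient c + be m of 1 / v is nonnegative, because it has the sign of the
coefficient of v^m in the image, and that coefficient is a probability.  Hence
all terms have an imaginary part of the sign opposite to that of v, or zero;
if all are zero, then c + be m = 0, all p_j are 1, and the sum is 1.  Either way
the image cannot vanish at v.  So the roots of f_(n+1) are real, and since its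
coefficients are nonnegative they are nonpositive: f_(n+1) is again a product of
factors 1 - p + p v with p between 0 and 1.

Second, a sum of independent Bernoulli variables with variance sigma^2 is within
O(1 / sigma) of the normal law, uniformly (berry_esseen).  This is Stein's
method.  If z is the standardization of an integer, the Stein solution of
g' w = w g w + (w <= z) - Phi z is smooth on both sides of z, and no step of the
standardized lattice contains z in its interior.  Inserting its increments in
the exchange identity for E[(S - mu) F(S)] bounds Phi z from above by P(W <= z)
and from below by P(W < z), up to O(1 / sigma), without any anti-concentration
estimate.  A general point lies between two consecutive lattice points.

Third, the variance of X_n grows at least linearly (variance_growth): with T_n
the total number of balls and p_n = E X_n / T_n,
    V_(n+1) = V_n (1 - 2 sg / T_n) + sg^2 p_n (1 - p_n),
and p_n tends to (b + s) / (a + b + 2 s), which is strictly between 0 and 1. *)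

(** * The Gaussian distribution function and the Stein equation *)

Section Gauss.
Variable R : realType.
Implicit Types x w : R.

Definition phi x : R := (Num.sqrt (2 * pi))^-1 * expR (- (x ^+ 2 / 2)).

Definition Phi x : R := (Num.sqrt (2 * pi))^-1 *
  \int[lebesgue_measure]_(y in `]-oo, x]) expR (- (y ^+ 2 / 2)).

Lemma phiE : phi = normal_pdf 0 1.
Proof.
apply/funext => x; rewrite normal_pdfE ?oner_eq0// /phi /normal_peak.
by rewrite /normal_fun expr1n mul1r subr0 mulNr (mulr_natl pi).
Qed.

Lemma integrable_phi (A : set R) : measurable A ->
  lebesgue_measure.-integrable A (EFin \o phi).
Proof.
move=> mA; rewrite phiE; apply: integrableS (integrable_normal_pdf 0 1) => //.
Qed.

Lemma PhiE x : Phi x = \int[lebesgue_measure]_(y in `]-oo, x]) phi y.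
Proof.
have K0 : (Num.sqrt (2 * pi))^-1 != 0 :> R.
  by rewrite invr_eq0 gt_eqF// sqrtr_gt0 mulr_gt0// pi_gt0.
rewrite /Phi /phi RintegralZl//.
have -> : (EFin \o (fun x : R => expR (- (x ^+ 2 / 2)))) =
   (fun x => (Num.sqrt (2 * pi))%:E * (phi x)%:E)%E.
  apply/funext => y /=; rewrite -EFinM /phi mulrA divff ?mul1r//.
  by rewrite -invr_eq0.
by apply: integrableZl => //; exact: integrable_phi.
Qed.

Let idTR : measurableTypeR R -> R := idfun.

#[local] HB.instance Definition _ :=
  @isMeasurableFun.Build _ _ _ _ idTR (@measurable_id _ _ setT).

(** Through this identification Phi inherits its limits and its monotonicity. *)
Lemma Phi_cdf x : (Phi x)%:E = cdf (idTR : {RV (normal_prob (0:R) 1) >-> R}) x.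
Proof.
rewrite /cdf /distribution /pushforward /= preimage_id PhiE phiE /normal_prob.
rewrite /Rintegral fineK//; apply: integrable_fin_num => //.
rewrite -phiE; exact: integrable_phi.
Qed.

Lemma continuous_phi : continuous phi.
Proof. by rewrite phiE; apply: continuous_normal_pdf; exact: oner_neq0. Qed.

Lemma phi_gt0 x : 0 < phi x.
Proof. by rewrite mulr_gt0 ?expR_gt0// invr_gt0 sqrtr_gt0 mulr_gt0// pi_gt0. Qed.

Lemma is_derive_Phi x : is_derive x 1 Phi (phi x).
Proof.
have [] := @continuous_FTC1 R phi -oo%O x (x + 1).
- by rewrite ltrDl.
- exact: integrable_phi.
- by rewrite ltNyr.
- exact: continuous_phi.
rewrite (_ : (fun x => _) = Phi); last by apply/funext => y; rewrite PhiE.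
by move=> dP <-; rewrite derive1E; exact: DeriveDef.
Qed.

Lemma is_derive_gauss (c x : R) :
  is_derive x 1 (fun x => expR (c * (x ^+ 2 / 2))) (c * x * expR (c * (x ^+ 2 / 2))).
Proof.
have h : is_derive x 1 (fun x : R => c * (x ^+ 2 / 2)) (c * x).
  have -> : (fun x : R => c * (x ^+ 2 / 2)) = (c / 2) \*: (@GRing.exp R^~ 2).
    by apply/funext => y /=; rewrite /GRing.scale /=; ring.
  by apply: is_derive_eq; rewrite /GRing.scale /=; field.
have := @is_derive1_comp _ expR (fun x : R => c * (x ^+ 2 / 2)) x _ _
  (is_derive_expR _) h.
by move=> k; apply: is_derive_eq; rewrite mulrC.
Qed.

Lemma is_derive_phi x : is_derive x 1 phi (- x * phi x).
Proof.
have h := is_derive_gauss (-1) x.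
have -> : phi = (Num.sqrt (2 * pi))^-1 \*: (fun x => expR (-1 * (x ^+ 2 / 2))).
  by apply/funext => y; rewrite /phi /= mulN1r.
by apply: is_derive_eq; rewrite /phi /= /GRing.scale /= !mulN1r; ring.
Qed.

Lemma is_derive_phiV x : is_derive x 1 (fun x => (phi x)^-1) (x / phi x).
Proof.
have h := is_derive_gauss 1 x.
have E y : (phi y)^-1 = Num.sqrt (2 * pi) * expR (1 * (y ^+ 2 / 2)).
  by rewrite /phi invfM invrK expRN invrK mul1r.
have -> : (fun x => (phi x)^-1) = Num.sqrt (2 * pi) \*: (fun x => expR (1 * (x ^+ 2 / 2))).
  by apply/funext => y; rewrite /= E.
by apply: is_derive_eq; rewrite E /GRing.scale /=; ring.
Qed.

Lemma Phi_cvgy : Phi x @[x --> +oo] --> (1 : R).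
Proof.
have := @cvg_cdfy1 _ _ _ (normal_prob (0:R) 1) idTR.
move/fine_cvg; apply: cvg_trans; apply: near_eq_cvg.
near=> x; rewrite /=; by have /= <- := Phi_cdf x.
Unshelve. all: by end_near. Qed.

Lemma Phi_cvgNy : Phi x @[x --> -oo] --> (0 : R).
Proof.
have := @cvg_cdfNy0 _ _ _ (normal_prob (0:R) 1) idTR.
move/fine_cvg; apply: cvg_trans; apply: near_eq_cvg.
near=> x; rewrite /=; by have /= <- := Phi_cdf x.
Unshelve. all: by end_near. Qed.

Lemma Phi_ge0 x : 0 <= Phi x.
Proof. by rewrite -lee_fin Phi_cdf cdf_ge0. Qed.

Lemma Phi_le1 x : Phi x <= 1.
Proof. by rewrite -lee_fin Phi_cdf cdf_le1. Qed.

Lemma Phi_nondecr : {homo Phi : x y / x <= y}.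
Proof. by move=> x y xy; rewrite -lee_fin !Phi_cdf cdf_nondecreasing. Qed.

Lemma phi_le1 x : phi x <= 1.
Proof.
have s1 : 1 <= Num.sqrt (2 * pi) :> R.
  by rewrite -[leLHS]sqrtr1 ler_wsqrtr//; have := pi_ge2 R; lra.
rewrite /phi mulr_ile1 ?invr_ge0 ?sqrtr_ge0 ?expR_ge0//.
  by rewrite invf_le1// (lt_le_trans _ s1).
by rewrite expR_le1 oppr_le0 divr_ge0// sqr_ge0.
Qed.

Lemma phiN x : phi (- x) = phi x.
Proof. by rewrite /phi sqrrN. Qed.

Lemma MVT_is_derive (f df : R -> R) (a b : R) : a <= b ->
  (forall x, a <= x <= b -> is_derive x 1 f (df x)) ->
  exists2 c, a <= c <= b & f b - f a = df c * (b - a).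
Proof.
move=> ab fdf.
have [||c] := @MVT_segment R f df a b ab.
- by move=> x; rewrite in_itv /= => /andP[ax xb]; apply: fdf; rewrite !ltW.
- apply: derivable_within_continuous => x; rewrite in_itv /= => axb.
  by have := fdf x axb => -[].
by rewrite in_itv /= => cab E; exists c.
Qed.

(** The function phi x / x - H x decreases on the positive half-line, its
derivative being - phi x / x^2, and it is bounded below by - H x, which tends
to 0; so it is nonnegative. *)
Lemma mills (H : R -> R) : (forall x, is_derive x 1 H (- phi x)) ->
  H x @[x --> +oo] --> (0 : R) -> forall w, 0 < w -> w * H w <= phi w.
Proof.
move=> dH H0 w w0.
pose k x := x^-1 * phi x - H x.
have dk x : 0 < x -> is_derive x 1 k (- (phi x / x ^+ 2)).
  move=> x0; have xn0 : x != 0 by rewrite gt_eqF.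
  have := @is_deriveV R id x 1 1 xn0 (is_derive_id x (1:R)).
  move=> dV; have := is_derive_phi x; have := dH x => ? ?.
  rewrite /k; apply: is_derive_eq.
  by rewrite /GRing.scale /=; field.
have kdecr x : w <= x -> k x <= k w.
  move=> wx; have [|c /andP[wc _] E] := @MVT_is_derive k (fun x => - (phi x / x ^+ 2)) w x wx.
    by move=> y /andP[wy _]; apply: dk; exact: lt_le_trans wy.
  rewrite -subr_le0 E mulr_le0_ge0 ?subr_ge0// oppr_le0.
  by rewrite divr_ge0 ?sqr_ge0// ltW ?phi_gt0.
suff : - k w <= 0.
  by rewrite oppr_le0 subr_ge0 => h; rewrite -ler_pdivlMl.
rewrite -(cvg_lim _ H0)//; apply: limr_ge; first by apply/cvg_ex; exists 0.
near=> x.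
have h : k x <= k w by apply: kdecr; near: x; apply: nbhs_pinfty_ge; rewrite num_real.
have x0 : 0 <= x by near: x; apply: nbhs_pinfty_ge; rewrite num_real.
have h0 : 0 <= x^-1 * phi x by rewrite mulr_ge0 ?invr_ge0// ltW// phi_gt0.
by move: h; rewrite {1}/k; lra.
Unshelve. all: by end_near. Qed.

(** The Mills ratios of the left and the right tail.  They solve g' = w g + 1 and
g' = w g - 1, and their multiples are the two branches of the Stein solution. *)
Definition millsL w := Phi w / phi w.
Definition millsR w := (1 - Phi w) / phi w.

(** A bound for both Mills ratios, each on its own half-line: a tail is at most 1
and phi is at least phi 1 on the unit interval, while beyond it the ratio is at
most 1 by [mills]. *)
Definition millsC : R := (phi 1)^-1.

Lemma millsL_ge0 w : 0 <= millsL w.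
Proof. by rewrite divr_ge0 ?Phi_ge0// ltW ?phi_gt0. Qed.

Lemma millsR_ge0 w : 0 <= millsR w.
Proof. by rewrite divr_ge0 ?subr_ge0 ?Phi_le1// ltW ?phi_gt0. Qed.

Lemma millsC_ge1 : 1 <= millsC.
Proof. by rewrite invf_ge1 ?phi_gt0 ?phi_le1. Qed.

Lemma phi_ge_phi1 w : `|w| <= 1 -> phi 1 <= phi w.
Proof.
move=> w1; rewrite ler_pM2l ?invr_gt0 ?sqrtr_gt0 ?mulr_gt0 ?pi_gt0//.
rewrite ler_expR lerN2 ler_pM2r ?invr_gt0// expr1n.
by rewrite -real_normK ?num_real// expr_le1.
Qed.

Lemma mul_millsR_le1 w : 0 <= w -> w * millsR w <= 1.
Proof.
rewrite le_eqVlt => /orP[/eqP<-|w0]; first by rewrite mul0r.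
rewrite mulrA ler_pdivrMr ?phi_gt0// mul1r.
apply: (@mills (fun x => 1 - Phi x)) => //.
  by move=> x; have ? := is_derive_Phi x; apply: is_derive_eq; rewrite add0r mul1r.
by rewrite -[X in _ --> X](subrr 1); apply: cvgB; [exact: cvg_cst|exact: Phi_cvgy].
Qed.

Lemma mul_millsL_le1 w : w <= 0 -> - w * millsL w <= 1.
Proof.
rewrite le_eqVlt => /orP[/eqP->|w0]; first by rewrite oppr0 mul0r.
rewrite mulrA ler_pdivrMr ?phi_gt0// mul1r.
rewrite -[in leRHS]phiN -[w in Phi w]opprK.
apply: (@mills (fun x => Phi (- x))); last by rewrite oppr_gt0.
  move=> x; have ? := is_derive_Phi (- x).
  have := @is_derive1_comp _ Phi (fun x => - x) x _ _ (is_derive_Phi _) _.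
  move=> h; have := h _ (is_deriveN (is_derive_id x (1:R))) => h'.
  by apply: is_derive_eq; rewrite phiN mulrN1.
by apply: (cvgNy_compNP Phi _).1; exact: Phi_cvgNy.
Qed.

Lemma millsR_leC w : 0 <= w -> millsR w <= millsC.
Proof.
move=> w0; have [w1|w1] := leP w 1.
  rewrite /millsR /millsC -[leRHS]mul1r ler_pM ?subr_ge0 ?Phi_le1 ?invr_ge0//.
  - by rewrite ltW ?phi_gt0.
  - by rewrite lerBlDr lerDl Phi_ge0.
  - by rewrite lef_pV2 ?posrE ?phi_gt0// phi_ge_phi1// ger0_norm.
apply: le_trans millsC_ge1; apply: le_trans (mul_millsR_le1 w0).
by rewrite ler_peMl ?millsR_ge0// ltW.
Qed.

Lemma millsL_leC w : w <= 0 -> millsL w <= millsC.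
Proof.
move=> w0; have [w1|w1] := leP (- w) 1.
  rewrite /millsL /millsC -[leRHS]mul1r ler_pM ?Phi_ge0 ?invr_ge0//.
  - by rewrite ltW ?phi_gt0.
  - by rewrite Phi_le1.
  - by rewrite lef_pV2 ?posrE ?phi_gt0// phi_ge_phi1// ler0_norm.
apply: le_trans millsC_ge1; apply: le_trans (mul_millsL_le1 w0).
by rewrite ler_peMl ?millsL_ge0// ltW.
Qed.

Lemma is_derive_millsL w : is_derive w 1 millsL (w * millsL w + 1).
Proof.
have d1 := is_derive_Phi w; have d2 := is_derive_phiV w.
rewrite /millsL; apply: is_derive_eq.
by rewrite /GRing.scale /=; field; rewrite gt_eqF ?phi_gt0.
Qed.

Lemma is_derive_millsR w : is_derive w 1 millsR (w * millsR w - 1).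
Proof.
have d1 := is_derive_Phi w; have d2 := is_derive_phiV w.
rewrite /millsR; apply: is_derive_eq.
by rewrite /GRing.scale /=; field; rewrite gt_eqF ?phi_gt0.
Qed.

(** On the far side of 0 the left Mills ratio is unbounded, but there the factor
1 - Phi z is at most 1 - Phi w, and millsL w * (1 - Phi w) = Phi w * millsR w. *)
Lemma steinL_bound z w : w <= z -> let g := millsL w * (1 - Phi z) in
  [/\ 0 <= g, g <= millsC & `|w * g| <= 1].
Proof.
move=> wz g.
have z01 : 0 <= 1 - Phi z <= 1 by rewrite subr_ge0 Phi_le1 lerBlDr lerDl Phi_ge0.
have g0 : 0 <= g by rewrite mulr_ge0 ?millsL_ge0//; case/andP: z01.
rewrite normrM (ger0_norm g0).
have [w0|w0] := leP w 0.
  have gM : g <= millsL w by rewrite ler_piMr ?millsL_ge0//; case/andP: z01.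
  split=> //; first exact: le_trans (millsL_leC w0).
  by rewrite ler0_norm// (le_trans _ (mul_millsL_le1 w0))// ler_wpM2l// oppr_ge0.
have gM : g <= millsR w.
  apply: (@le_trans _ _ (millsL w * (1 - Phi w))).
    by rewrite ler_wpM2l ?millsL_ge0// lerB// Phi_nondecr.
  rewrite /millsL mulrAC -mulrA; rewrite ler_piMl ?Phi_le1//.
  exact: millsR_ge0.
split=> //; first by rewrite (le_trans gM)// millsR_leC// ltW.
by rewrite (ger0_norm (ltW w0)) (le_trans _ (mul_millsR_le1 (ltW w0)))// ler_wpM2l// ltW.
Qed.

Lemma steinR_bound z w : z <= w -> let g := millsR w * Phi z in
  [/\ 0 <= g, g <= millsC & `|w * g| <= 1].
Proof.
move=> wz g.
have g0 : 0 <= g by rewrite mulr_ge0 ?millsR_ge0 ?Phi_ge0.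
rewrite normrM (ger0_norm g0).
have [w0|w0] := leP 0 w.
  have gM : g <= millsR w by rewrite ler_piMr ?millsR_ge0 ?Phi_le1.
  split=> //; first by rewrite (le_trans gM)// millsR_leC.
  by rewrite ger0_norm// (le_trans _ (mul_millsR_le1 w0))// ler_wpM2l.
have gM : g <= millsL w.
  apply: (@le_trans _ _ (millsR w * Phi w)).
    by rewrite ler_wpM2l ?millsR_ge0// Phi_nondecr.
  rewrite /millsR mulrAC -mulrA; rewrite ler_piMl ?millsL_ge0//.
  by rewrite lerBlDr lerDl Phi_ge0.
split=> //; first by rewrite (le_trans gM)// millsL_leC// ltW.
by rewrite (ler0_norm (ltW w0)) (le_trans _ (mul_millsL_le1 (ltW w0)))// ler_wpM2l// oppr_ge0 ltW.
Qed.

(** The bounded solution of g' w = w g w + (w <= z) - Phi z.  Its derivative jumps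
at z, so its increments are estimated on each side of z separately. *)
Definition stein z w :=
  if w <= z then millsL w * (1 - Phi z) else millsR w * Phi z.

(** By the mean value theorem the increment is (v - u) * (x g x + k) for some x.
Moving x to w inside the product x g x costs at most
|x - w| |g x| + |w| |g x - g w|, and g is 2-Lipschitz. *)
Lemma stein_increment (g : R -> R) (k c u v w : R) : 0 <= c ->
  u <= w <= v ->
  (forall x, u <= x <= v -> [/\ is_derive x 1 g (x * g x + k), `|g x| <= c &
     `|x * g x + k| <= 2]) ->
  `|(g v - g u) - (v - u) * (w * g w + k)| <= (v - u) ^+ 2 * (c + 2 * `|w|).
Proof.
move=> c0 /andP[uw wv] H.
have uv : u <= v := le_trans uw wv.
have [|x /andP[ux xv] ->] := @MVT_is_derive g (fun x => x * g x + k) u v uv.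
  by move=> x xuv; have [] := H x xuv.
have lip : `|g x - g w| <= 2 * (v - u).
  wlog : x w ux xv uw wv / w <= x => [wl|wx].
    by have [wx|/ltW xw] := leP w x; [|rewrite distrC]; apply: wl.
  have [|y /andP[wy yx] ->] := @MVT_is_derive g (fun x => x * g x + k) w x wx.
    move=> y /andP[wy yx].
    by have [] := H y; rewrite // (le_trans uw wy) (le_trans yx xv).
  have [|_ _ d2] := H y; first by rewrite (le_trans uw wy) (le_trans yx xv).
  by rewrite normrM ler_pM// ger0_norm ?subr_ge0// lerB.
have xw : `|x - w| <= v - u.
  by rewrite ler_norml; apply/andP; split; move: ux xv uw wv; lra.
have [|_ gx _] := H x; first by rewrite ux xv.
have -> : (x * g x + k) * (v - u) - (v - u) * (w * g w + k) =
  (v - u) * ((x - w) * g x + w * (g x - g w)) by ring.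
rewrite normrM ger0_norm ?subr_ge0// expr2 -mulrA ler_wpM2l ?subr_ge0//.
apply: le_trans (ler_normD _ _) _; rewrite [leRHS]mulrDr; apply: lerD.
  by rewrite normrM ler_pM.
rewrite normrM (_ : (v - u) * (2 * `|w|) = `|w| * (2 * (v - u))); last by ring.
by rewrite ler_wpM2l.
Qed.

Lemma stein_incrementL z u v w : u <= w <= v -> v <= z ->
  `|(stein z v - stein z u) - (v - u) * (w * stein z w + 1 - Phi z)|
    <= (v - u) ^+ 2 * (millsC + 2 * `|w|).
Proof.
move=> /andP[uw wv] vz.
rewrite /stein vz (le_trans (le_trans uw wv) vz) (le_trans wv vz).
rewrite -[_ + 1 - Phi z]addrA.
apply: (@stein_increment (fun x => millsL x * (1 - Phi z)) (1 - Phi z)).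
- exact: le_trans millsC_ge1.
- by rewrite uw wv.
move=> x /andP[ux xv]; have [g0 gC wg] := steinL_bound (le_trans xv vz).
have dM := is_derive_millsL x.
split.
- by apply: is_derive_eq; rewrite /GRing.scale /=; ring.
- by rewrite ger0_norm.
- apply: le_trans (ler_normD _ _) _; rewrite -[leRHS]/(1 + 1); apply: lerD => //.
  by rewrite ger0_norm ?subr_ge0 ?Phi_le1// lerBlDr lerDl Phi_ge0.
Qed.

Lemma stein_incrementR z u v w : u <= w <= v -> z <= u ->
  `|(stein z v - stein z u) - (v - u) * (w * stein z w - Phi z)|
    <= (v - u) ^+ 2 * (millsC + 2 * `|w|).
Proof.
move=> /andP[uw wv] zu.
have steinE x : z <= x -> stein z x = millsR x * Phi z.
  rewrite /stein le_eqVlt => /orP[/eqP<-|]; last by rewrite ltNge => /negPf->.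
  by rewrite lexx /millsL /millsR mulrAC [RHS]mulrAC (mulrC (Phi z)).
rewrite !steinE ?(le_trans zu (le_trans uw wv)) ?(le_trans zu uw)//.
apply: (@stein_increment (fun x => millsR x * Phi z) (- Phi z)).
- exact: le_trans millsC_ge1.
- by rewrite uw wv.
move=> x /andP[ux xv]; have [g0 gC wg] := steinR_bound (le_trans zu ux).
have dM := is_derive_millsR x.
split.
- by apply: is_derive_eq; rewrite /GRing.scale /=; ring.
- by rewrite ger0_norm.
- apply: le_trans (ler_normB _ _) _; rewrite -[leRHS]/(1 + 1); apply: lerD => //.
  by rewrite ger0_norm ?Phi_ge0 ?Phi_le1.
Qed.

End Gauss.

(** * Real-rootedness of the urn recurrence *)

Section RealRooted.
Variable R : realType.
Implicit Types (c be p : R) (ps : seq R) (f g : {poly R}).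
Local Notation C := R[i].
Local Notation toC := (real_complex R).

Definition bernoulli_poly p : {poly R} := (1 - p)%:P + p *: 'X.

(** The generating polynomial of a sum of independent Bernoulli variables. *)
Definition pbin_poly ps : {poly R} := \prod_(p <- ps) bernoulli_poly p.

(** Parameters 0 are excluded so that the factors of [pbin_poly] correspond to its
roots. *)
Definition pos_prob : pred R := fun p => (0 < p) && (p <= 1).

(** The effect on generating polynomials of one step of a walk that goes from k to
k + 1 with probability 1 - (c + be k), and stays at k otherwise; see
[urn_op_coef]. *)
Definition urn_op c be f : {poly R} :=
  (c%:P + (1 - c) *: 'X) * f + be *: ('X * (1 - 'X) * f^`()).

Lemma pbin_poly_at1 ps : (pbin_poly ps).[1] = 1.
Proof.
rewrite horner_prod big1// => p _.
by rewrite !hornerE subrK.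
Qed.

Lemma urn_op_at1 c be ps : (urn_op c be (pbin_poly ps)).[1] = 1.
Proof. by rewrite /urn_op !hornerE /= pbin_poly_at1; ring. Qed.

Lemma pbin_poly_split ps :
  pbin_poly ps = 'X^(count (pred1 1) ps) * pbin_poly [seq p <- ps | p != 1].
Proof.
rewrite /pbin_poly; elim: ps => [|p ps IH]; first by rewrite /= !big_nil expr0 mulr1.
rewrite big_cons IH /=; case: eqVneq => [->|p1] /=.
  by rewrite /bernoulli_poly subrr add0r scale1r exprS mulrA.
by rewrite big_cons mulrCA.
Qed.

Lemma pbin_poly_at0_gt0 ps : all pos_prob ps -> all (fun p => p != 1) ps ->
  0 < (pbin_poly ps).[0].
Proof.
move=> /allP h1 /allP h2; rewrite horner_prod big_seq prodr_gt0// => p pps.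
have /andP[_ p1] := h1 p pps; have pn1 := h2 p pps.
by rewrite !hornerE subr_gt0 lt_neqAle pn1.
Qed.

Lemma urn_op_coef c be f k : (urn_op c be f)`_k =
  f`_k * (c + be * k%:R) +
  (if k is k'.+1 then f`_k' * (1 - (c + be * k'%:R)) else 0).
Proof.
have -> : urn_op c be f = c *: f + (1 - c) *: ('X * f) + be *: ('X * f^`() - 'X * ('X * f^`())).
  by rewrite /urn_op -!mul_polyC; ring.
have Xd j : ('X * f^`())`_j = f`_j * j%:R.
  rewrite coefXM; case: j => [|j] /=; first by rewrite mulr0.
  by rewrite coef_deriv mulr_natr.
rewrite !coefD !coefZ coefB Xd (coefXM ('X * _)) (coefXM f).
case: k => [|k]; first by rewrite eqxx; ring.
rewrite [_.-1]/= Xd; move: (f`_k.+1) (f`_k) (k.+1%:R) (k%:R) => u v m l.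
by rewrite /=; ring.
Qed.

(** Let m be the multiplicity of the root 0.  The coefficient of 'X^m in the image
is c + be m times the value at 0 of the remaining factors, which is positive. *)
Lemma urn_op_weight_ge0 c be ps : all pos_prob ps ->
  (forall k, 0 <= (urn_op c be (pbin_poly ps))`_k) ->
  0 <= c + be * (count (pred1 1) ps)%:R.
Proof.
move=> ps01; set m := count _ ps => /(_ m).
rewrite pbin_poly_split -/m; set h := pbin_poly _.
have h0 : 0 < h.[0].
  apply: pbin_poly_at0_gt0; last exact: filter_all.
  by apply/allP => p; rewrite mem_filter => /andP[_]; apply: (allP ps01).
have XXm : 'X * ('X^m)^`() = m%:R *: 'X^m :> {poly R}.
  rewrite derivXn; case: (m) => [|k]; first by rewrite mulr0n mulr0 scale0r.
  by rewrite /= mulrnAr -exprS -mulr_natl scaler_nat mulr_natl.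
have -> : urn_op c be ('X^m * h) = 'X^m * ((c%:P + (1 - c) *: 'X) * h
    + be *: ((1 - 'X) * (m%:R *: h + 'X * h^`()))).
  rewrite /urn_op derivM mulrDr.
  have -> : 'X * (1 - 'X) * (('X^m)^`() * h) = (1 - 'X) * (m%:R *: ('X^m * h)).
    by rewrite scalerAl -XXm; ring.
  by rewrite -!mul_polyC; ring.
rewrite coefXnM ltnn subnn -horner_coef0 !hornerE /=.
set t := (X in 0 <= X -> _); have -> : t = (c + be * m%:R) * h.[0].
  by rewrite /t; ring.
by rewrite pmulr_lge0.
Qed.

Lemma log_deriv_pbin_poly (qs : seq C) (z : C) (F := fun p : C => (1 - p)%:P + p *: 'X) :
  (forall p : C, p \in qs -> 1 - p + p * z != 0) ->
  (\prod_(p <- qs) F p)^`().[z] =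
    (\prod_(p <- qs) F p).[z] * \sum_(p <- qs) p / (1 - p + p * z).
Proof.
elim: qs => [|p qs IH] H; first by rewrite !big_nil mulr0 -polyC1 derivC horner0.
rewrite !big_cons derivM hornerD !hornerM IH; last first.
  by move=> x xqs; apply: H; rewrite inE xqs orbT.
have p0 : 1 - p + p * z != 0 by apply: H; rewrite mem_head.
rewrite /F derivD derivC derivZ derivX !hornerE /=.
by field.
Qed.

Lemma Im_inv (w : C) : complex.Im w^-1 = - complex.Im w / (complex.Re w ^+ 2 + complex.Im w ^+ 2).
Proof. by case: w => x y /=; rewrite mulNr. Qed.

(** Dividing the image by z f(z) gives
E = c / z + (1 - c) + be * sum_j (1 / (1 - p_j + p_j z) - 1).  Its imaginary part is
- Im z times a combination of inverse square moduli, in which the terms p_j = 1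
are gathered with c / z so that all weights are nonnegative.  If E vanishes, all
weights vanish, which forces f to be a power of 'X and then E = 1. *)
Lemma urn_op_root_real c be ps (z : C) : 0 < be -> all pos_prob ps ->
  (forall k, 0 <= (urn_op c be (pbin_poly ps))`_k) ->
  root (map_poly toC (urn_op c be (pbin_poly ps))) z -> complex.Im z = 0.
Proof.
move=> be0 ps01 g0 rz; apply/eqP; apply: contraT => Imz0.
have N0 (w : C) : complex.Im w != 0 -> 0 < complex.Re w ^+ 2 + complex.Im w ^+ 2.
  by move=> w0; rewrite ltr_wpDl ?sqr_ge0// lt_neqAle sqr_ge0 andbT eq_sym sqrf_eq0.
have z0 : z != 0 by apply: contraNneq Imz0 => ->.
have Imq p : complex.Im (1 - toC p + toC p * z) = p * complex.Im z.
  by case: (z) => x y /=; ring.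
have q0 p : p \in ps -> 1 - toC p + toC p * z != 0.
  move=> /(allP ps01)/andP[p0 _]; apply: contraNneq Imz0 => /(congr1 (@complex.Im R)).
  by rewrite Imq => /eqP; rewrite mulf_eq0 gt_eqF.
pose f := \prod_(p <- map toC ps) ((1 - p)%:P + p *: 'X).
have fE : map_poly toC (pbin_poly ps) = f.
  rewrite /f big_map rmorph_prod; apply: eq_bigr => p _.
  by rewrite /bernoulli_poly rmorphD /= map_polyC map_polyZ map_polyX /= rmorphB rmorph1.
have fz0 : f.[z] != 0.
  rewrite horner_prod big_map prodf_seq_neq0; apply/allP => p pps /=.
  by rewrite !hornerE /= q0.
have f'z : f^`().[z] = f.[z] * \sum_(p <- ps) toC p / (1 - toC p + toC p * z).
  rewrite /f log_deriv_pbin_poly ?big_map// => p /mapP[r rps ->]; exact: q0.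
pose S := \sum_(p <- ps) ((1 - toC p + toC p * z)^-1 - 1).
have SE : (1 - z) * \sum_(p <- ps) toC p / (1 - toC p + toC p * z) = S.
  rewrite big_distrr /= /S big_seq [RHS]big_seq; apply: eq_bigr => p /q0 pq0.
  by field.
have TE : map_poly toC (urn_op c be (pbin_poly ps)) =
    ((toC c)%:P + (1 - toC c) *: 'X) * f + toC be *: ('X * (1 - 'X) * f^`()).
  rewrite /urn_op rmorphD /= rmorphM /= [in LHS]rmorphD /= !map_polyZ /= map_polyC /=.
  rewrite !rmorphM /= !rmorphB /= !rmorph1 !map_polyX.
  by rewrite -deriv_map fE.
have E : toC c / z + (1 - toC c) + toC be * S = 0.
  move: rz; rewrite /root TE !hornerE /= f'z => /eqP h.
  by apply: (mulfI (mulf_neq0 z0 fz0)); rewrite mulr0 -[RHS]h -SE; field.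
pose n2 (w : C) := complex.Re w ^+ 2 + complex.Im w ^+ 2.
have ImD (x y : C) : complex.Im (x + y) = complex.Im x + complex.Im y.
  by case: x y => [x1 x2] [y1 y2].
have ImZ (r : R) (x : C) : complex.Im (toC r * x) = r * complex.Im x.
  by case: x => x1 x2 /=; ring.
(* The imaginary part of E, divided by - Im z. *)
have E' : c / n2 z + be * \sum_(p <- ps) p / n2 (1 - toC p + toC p * z) = 0.
  apply: (mulfI (x := - complex.Im z)); first by rewrite oppr_eq0.
  rewrite mulr0 -[RHS](congr1 (@complex.Im R) E) !ImD !ImZ Im_inv -/(n2 z).
  rewrite /S (big_morph (@complex.Im R) ImD (erefl : complex.Im (0 : C) = 0)).
  have -> : complex.Im (1 : C) = 0 by [].
  have -> : complex.Im (- toC c) = 0 by rewrite /= oppr0.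
  rewrite !addr0 mulrDr; congr +%R; first by rewrite mulrCA.
  rewrite mulrCA; congr (_ * _); rewrite big_distrr /=; apply: eq_bigr => p _.
  rewrite ImD Im_inv -/(n2 _) Imq.
  have -> : complex.Im (-1 : C) = 0 by rewrite /= oppr0.
  by rewrite addr0; ring.
have term1 p : p = 1 -> p / n2 (1 - toC p + toC p * z) = (n2 z)^-1.
  by move=> ->; rewrite rmorph1 subrr add0r !mul1r.
have E2 : (c + be * (count (pred1 1) ps)%:R) / n2 z +
    be * \sum_(p <- ps | p != 1) p / n2 (1 - toC p + toC p * z) = 0.
  rewrite -[RHS]E' [in RHS](bigID (fun p => p == 1)) /= mulrDl -!addrA.
  rewrite mulrDr; congr (_ + (_ + _)); rewrite -mulrA; congr (_ * _).
  rewrite (eq_bigr (fun=> (n2 z)^-1)); last by move=> p /eqP /term1.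
  by rewrite big_const_seq iter_addr_0 mulr_natl; congr (_ *+ _); apply: eq_count.
have cm0 := urn_op_weight_ge0 ps01 g0.
have z2 := N0 z Imz0.
have S0 : 0 <= \sum_(p <- ps | p != 1) p / n2 (1 - toC p + toC p * z).
  rewrite big_seq_cond sumr_ge0// => p /andP[/(allP ps01)/andP[p0 _] _].
  by rewrite divr_ge0 ?addr_ge0 ?sqr_ge0// ltW.
have [cm S1] : c + be * (count (pred1 1) ps)%:R = 0 /\
   \sum_(p <- ps | p != 1) p / n2 (1 - toC p + toC p * z) = 0.
  have h1 : 0 <= (c + be * (count (pred1 1) ps)%:R) / n2 z.
    by rewrite divr_ge0// ltW.
  have h2 := mulr_ge0 (ltW be0) S0.
  move/eqP: E2; rewrite paddr_eq0// mulf_eq0 invr_eq0 (gt_eqF z2) orbF.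
  by rewrite mulf_eq0 (gt_eqF be0) /= => /andP[/eqP ? /eqP ?].
have ps1 : all (pred1 1) ps.
  apply: contraT => /allPn[p pps p1].
  have p0 : 0 < p by have /andP[] := allP ps01 p pps.
  have : 0 < \sum_(p <- ps | p != 1) p / n2 (1 - toC p + toC p * z).
    rewrite (big_rem p)//= ifT//; apply: ltr_wpDr.
      rewrite big_seq_cond sumr_ge0// => r /andP[/mem_rem/(allP ps01)/andP[r0 _] _].
      by rewrite divr_ge0 ?addr_ge0 ?sqr_ge0// ltW.
    by rewrite divr_gt0// N0// Imq mulf_neq0// gt_eqF.
  by rewrite S1 ltxx.
have SE1 : S = (count (pred1 1) ps)%:R * (z^-1 - 1).
  rewrite /S (eq_big_seq (fun=> z^-1 - 1)); last first.
    by move=> p /(allP ps1) /eqP ->; rewrite rmorph1 subrr add0r !mul1r.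
  rewrite big_const_seq iter_addr_0 mulr_natl count_predT.
  by move: ps1; rewrite all_count => /eqP ->.
(* Here all parameters are 1, so only the constant term of E survives. *)
have : toC (c + be * (count (pred1 1) ps)%:R) * (z^-1 - 1) + 1 = 0.
  by rewrite -[RHS]E SE1 rmorphD rmorphM /= rmorph_nat; ring.
by rewrite cm rmorph0 mul0r add0r => /eqP; rewrite oner_eq0.
Qed.

(** The monic factor with root r is 1 - r times the Bernoulli factor of parameter
1 / (1 - r). *)
Lemma pbin_poly_of_roots (rs : seq R) (l : R) : all (fun r => r <= 0) rs ->
  (l *: \prod_(r <- rs) ('X - r%:P)).[1] = 1 ->
  exists2 ps, all pos_prob ps & l *: \prod_(r <- rs) ('X - r%:P) = pbin_poly ps.
Proof.
move=> rs0; set g := _ *: _ => g1; exists [seq (1 - r)^-1 | r <- rs].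
  apply/allP => p /mapP[r /(allP rs0) r0 ->].
  have r1 : 1 <= 1 - r by rewrite lerDl oppr_ge0.
  by rewrite /pos_prob invr_gt0 invf_le1 ?(lt_le_trans ltr01 r1).
have gE : g = (l * \prod_(r <- rs) (1 - r)) *: pbin_poly [seq (1 - r)^-1 | r <- rs].
  rewrite /g -scalerA; congr (_ *: _); rewrite /pbin_poly big_map -scaler_prod.
  rewrite big_seq [RHS]big_seq; apply: eq_bigr => r /(allP rs0) r0.
  have r1 : 1 - r != 0 by rewrite gt_eqF// (lt_le_trans ltr01)// lerDl oppr_ge0.
  rewrite /bernoulli_poly scalerDr scalerA mulfV// scale1r addrC -polyCN.
  rewrite -mul_polyC -polyCM; have -> : (1 - r) * (1 - (1 - r)^-1) = - r by field.
  by [].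
move: g1; rewrite [in X in X -> _]gE hornerZ pbin_poly_at1 mulr1 => h.
by rewrite gE h scale1r.
Qed.

Lemma root_ge0_coef (g : {poly R}) r : g != 0 -> (forall k, 0 <= g`_k) ->
  root g r -> r <= 0.
Proof.
move=> gn0 g0; apply: contraTT; rewrite -ltNge => r0.
rewrite /root gt_eqF// horner_coef.
have sg : (0 < size g)%N by rewrite size_poly_gt0.
have i0 : ((size g).-1 < size g)%N by rewrite prednK.
rewrite (bigD1 (Ordinal i0)) //= ltr_pwDl ?mulr_gt0 ?exprn_gt0//.
  by rewrite lt_neqAle g0 eq_sym andbT -/(lead_coef g) lead_coef_eq0.
by rewrite sumr_ge0// => i _; rewrite mulr_ge0// exprn_ge0// ltW.
Qed.

(** Nonnegativity of the coefficients is used twice: to prove that the roots are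
real, and to exclude positive ones. *)
Lemma urn_op_pbin_poly c be ps : 0 < be -> all pos_prob ps ->
  (forall k, 0 <= (urn_op c be (pbin_poly ps))`_k) ->
  exists2 ps', all pos_prob ps' & urn_op c be (pbin_poly ps) = pbin_poly ps'.
Proof.
move=> be0 ps01 g0; set g := urn_op _ _ _.
have g1 : g.[1] = 1 by exact: urn_op_at1.
have gn0 : g != 0.
  by apply: contra_eq_neq g1 => ->; rewrite horner0 eq_sym oner_eq0.
have [rs Ers] := closed_field_poly_normal (map_poly toC g).
have rsr (z : C) : z \in rs -> z = toC (complex.Re z).
  move=> zrs; have : complex.Im z = 0.
    apply: (@urn_op_root_real c be ps) => //.
    rewrite -/g Ers rootZ ?root_prod_XsubC//.
    by rewrite lead_coef_eq0 map_poly_eq0.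
  by case: z {zrs} => x y /= ->.
have gE : g = lead_coef g *: \prod_(r <- map (@complex.Re R) rs) ('X - r%:P).
  apply: (map_poly_inj toC); rewrite Ers map_polyZ lead_coef_map; congr (_ *: _).
  rewrite big_map rmorph_prod big_seq [RHS]big_seq; apply: eq_bigr => z zrs.
  by rewrite rmorphB /= map_polyX map_polyC /= -rsr.
rewrite gE; apply: pbin_poly_of_roots; last by rewrite -gE.
apply/allP => r rrs; apply: (root_ge0_coef gn0 g0); rewrite gE rootZ ?lead_coef_eq0//.
by rewrite root_prod_XsubC.
Qed.

End RealRooted.

(** * Stein's method for sums of independent Bernoulli variables *)

Section PoissonBinomial.
Variable R : realType.
Implicit Types (p : R) (ps : seq R) (F G h : nat -> R).

(** The expectation of F (S), for S a sum of independent Bernoulli variables with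
parameters ps: condition on the first variable. *)
Fixpoint pbin_exp ps F : R :=
  if ps is p :: ps' then (1 - p) * pbin_exp ps' F + p * pbin_exp ps' (F \o S) else F 0%N.

Definition pbin_mean ps : R := \sum_(p <- ps) p.
Definition pbin_var ps : R := \sum_(p <- ps) p * (1 - p).

Lemma eq_pbin_exp ps F G : F =1 G -> pbin_exp ps F = pbin_exp ps G.
Proof. by move=> /funext ->. Qed.

Lemma pbin_expD ps F G : pbin_exp ps (fun k => F k + G k) = pbin_exp ps F + pbin_exp ps G.
Proof.
elim: ps F G => [//|p ps IH] F G /=.
by rewrite IH (IH (F \o S) (G \o S)); ring.
Qed.

Lemma pbin_expZ ps a F : pbin_exp ps (fun k => a * F k) = a * pbin_exp ps F.
Proof.
elim: ps F => [//|p ps IH] F /=.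
by rewrite IH (IH (F \o S)); ring.
Qed.

Lemma pbin_exp_cst ps a : pbin_exp ps (fun=> a) = a.
Proof. by elim: ps => [//|p ps IH] /=; rewrite (_ : _ \o S = (fun=> a))// IH; ring. Qed.

Lemma le_pbin_exp ps F G : all (@pos_prob R) ps -> (forall k, F k <= G k) -> pbin_exp ps F <= pbin_exp ps G.
Proof.
elim: ps F G => [|p ps IH] F G /=; first by move=> _; apply.
move=> /andP[/andP[p0 p1] ps01] FG; apply: lerD.
  by rewrite ler_wpM2l ?subr_ge0// IH.
by rewrite ler_wpM2l ?(ltW p0)// IH// => k; exact: FG.
Qed.

(** With S_i the sum without its i-th variable,
E[(S - mu) F(S)] = sum_i p_i (1 - p_i) E[F(S_i + 1) - F(S_i)].
Since S is either S_i or S_i + 1, a bound for each increment of F that is valid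
at both of its ends replaces S_i by S.  The induction on ps avoids naming S_i. *)
Lemma stein_comparison ps F h : all (@pos_prob R) ps ->
  (forall k, F k.+1 - F k <= h k) -> (forall k, F k.+1 - F k <= h k.+1) ->
  pbin_exp ps (fun k => (k%:R - pbin_mean ps) * F k) <= pbin_var ps * pbin_exp ps h.
Proof.
rewrite /pbin_mean /pbin_var.
elim: ps F h => [|p ps IH] F h /= ps01 h0 h1.
  by rewrite !big_nil subrr !mul0r.
move: ps01 => /andP[/andP[p0 p1] ps01]; rewrite !big_cons.
set m := \sum_(j <- ps) j; set v := \sum_(j <- ps) _.
have q0 : 0 <= 1 - p by rewrite subr_ge0.
have -> : pbin_exp ps (fun k => (k%:R - (p + m)) * F k) =
    pbin_exp ps (fun k => (k%:R - m) * F k) - p * pbin_exp ps F.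
  by rewrite -mulNr -pbin_expZ -pbin_expD; apply: eq_pbin_exp => k; ring.
have -> : pbin_exp ps ((fun k => (k%:R - (p + m)) * F k) \o S) =
    pbin_exp ps (fun k => (k%:R - m) * F k.+1) + (1 - p) * pbin_exp ps (F \o S).
  by rewrite -pbin_expZ -pbin_expD; apply: eq_pbin_exp => k /=; rewrite -natr1; ring.
have D : pbin_exp ps (F \o S) - pbin_exp ps F <= (1 - p) * pbin_exp ps h + p * pbin_exp ps (h \o S).
  have -> : pbin_exp ps (F \o S) - pbin_exp ps F = pbin_exp ps (fun k => F k.+1 - F k).
    by rewrite -mulN1r -pbin_expZ -pbin_expD; apply: eq_pbin_exp => k; rewrite /= mulN1r.
  have := le_pbin_exp ps01 h0; have := le_pbin_exp ps01 h1; rewrite -/(h \o S).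
  set a := pbin_exp _ _; set b := pbin_exp _ _; set c := pbin_exp _ _ => ab ac.
  have -> : a = (1 - p) * a + p * a by ring.
  by apply: lerD; rewrite ler_wpM2l// ltW.
have I0 := IH F h ps01 h0 h1.
have I1 := IH (F \o S) (h \o S) ps01 (fun k => h0 k.+1) (fun k => h1 k.+1).
have := ler_wpM2l q0 I0; have := ler_wpM2l (ltW p0) I1.
have := ler_wpM2l (mulr_ge0 (ltW p0) q0) D; rewrite -/m -/v /=.
lra.
Qed.

(** Two comparisons, for F k = k - mu and for its opposite, whose increments are
constant. *)
Lemma pbin_exp_variance ps : all (@pos_prob R) ps ->
  pbin_exp ps (fun k => (k%:R - pbin_mean ps) ^+ 2) = pbin_var ps.
Proof.
move=> ps01; apply/eqP; rewrite eq_le; apply/andP; split.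
  have := @stein_comparison ps (fun k => k%:R - pbin_mean ps) (fun=> 1) ps01.
  rewrite pbin_exp_cst mulr1; apply => k; rewrite -natr1; lra.
have := @stein_comparison ps (fun k => - (k%:R - pbin_mean ps)) (fun=> - 1) ps01.
rewrite pbin_exp_cst mulrN1.
have -> : pbin_exp ps (fun k => (k%:R - pbin_mean ps) * - (k%:R - pbin_mean ps)) =
  - pbin_exp ps (fun k => (k%:R - pbin_mean ps) ^+ 2).
  by rewrite -[RHS]mulN1r -pbin_expZ; apply: eq_pbin_exp => k; ring.
rewrite lerN2; apply => k; rewrite -natr1; lra.
Qed.

Lemma pbin_exp_mean ps : pbin_exp ps (fun k => k%:R) = pbin_mean ps.
Proof.
rewrite /pbin_mean; elim: ps => [|p ps IH] /=; first by rewrite big_nil.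
have -> : pbin_exp ps ((fun k => k%:R) \o S) = pbin_exp ps (fun k => k%:R) + 1.
  by rewrite -[X in _ + X](pbin_exp_cst ps) -pbin_expD; apply: eq_pbin_exp => k /=; rewrite natr1.
by rewrite IH big_cons; ring.
Qed.

Lemma pbin_exp_poly ps F n : (size ps < n)%N ->
  pbin_exp ps F = \sum_(k < n) (pbin_poly ps)`_k * F k.
Proof.
rewrite /pbin_poly; elim: ps F n => [|p ps IH] F [//|n] /=.
  rewrite big_nil big_ord_recl /= coef1 eqxx mul1r big1 ?addr0// => i _.
  by rewrite coef1 mul0r.
rewrite ltnS => sn; rewrite (IH F n.+1 (ltnW sn)) (IH (F \o S) n)//.
rewrite big_cons /bernoulli_poly.
set B := \prod_(j <- ps) _; set q := 1 - p.
have cB k : ((q%:P + p *: 'X) * B)`_k = q * B`_k + p * ('X * B)`_k.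
  by rewrite mulrDl coefD coefCM -scalerAl coefZ.
under [RHS]eq_bigr do rewrite cB mulrDl -!mulrA.
rewrite big_split /= -!big_distrr /=; congr (_ + _ * _).
rewrite big_ord_recl coefXM /= mul0r add0r; apply: eq_bigr => i _.
by rewrite coefXM.
Qed.

Section BerryEsseen.
Variables (ps : seq R) (ps01 : all (@pos_prob R) ps) (V0 : 0 < pbin_var ps).
Let mu := pbin_mean ps.
Let sg := Num.sqrt (pbin_var ps).
Let w (k : nat) : R := (k%:R - mu) / sg.
Local Notation c := (millsC R).

Let sg0 : 0 < sg. Proof. by rewrite sqrtr_gt0. Qed.

Let sgE : sg ^+ 2 = pbin_var ps. Proof. by rewrite sqr_sqrtr// ltW. Qed.

Let pbin_exp_absw : pbin_exp ps (fun k => `|w k|) <= 1.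
Proof.
(* |w| <= (1 + w^2) / 2 *)
have -> : 1 = pbin_exp ps (fun k => 2^-1 * (1 + w k ^+ 2)).
  rewrite pbin_expZ pbin_expD pbin_exp_cst.
  have -> : pbin_exp ps (fun k => w k ^+ 2) = (sg ^+ 2)^-1 * pbin_var ps.
    rewrite -(pbin_exp_variance ps01) -pbin_expZ; apply: eq_pbin_exp => k.
    by rewrite /w exprMn exprVn mulrC.
  by rewrite sgE mulVf ?gt_eqF//; field.
apply: le_pbin_exp => // k.
by have := sqr_ge0 (`|w k| - 1); rewrite sqrrB real_normK ?num_real//; lra.
Qed.

(** If F satisfies the one-sided, discretized form of F' = w F + G with an error
of second order in the mesh 1 / sigma, then the two terms E[w F] cancel and the
mean of G is almost nonnegative.  The error is integrable because E |w| <= 1. *)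
Lemma stein_ineq F G :
  (forall k i, (i == k) || (i == k.+1) ->
    F k.+1 - F k <= sg^-1 * (w i * F i + G i) + sg^-1 ^+ 2 * (c + 2 * `|w i|)) ->
  0 <= pbin_exp ps G + (c + 2) / sg.
Proof.
move=> H.
pose h i := sg^-1 * (w i * F i + G i) + sg^-1 ^+ 2 * (c + 2 * `|w i|).
have := @stein_comparison ps F h ps01.
rewrite -/mu /h pbin_expD !pbin_expZ !pbin_expD pbin_exp_cst pbin_expZ -sgE.
have -> : pbin_exp ps (fun k => (k%:R - mu) * F k) = sg * pbin_exp ps (fun k => w k * F k).
  by rewrite -pbin_expZ; apply: eq_pbin_exp => k; rewrite /w; field; rewrite gt_eqF.
move=> /(_ (fun k => H k k _))/(_ (fun k => H k k.+1 _)) h1.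
have {}h1 : sg * pbin_exp ps (fun k => w k * F k) <=
  sg * (pbin_exp ps (fun k => w k * F k) + pbin_exp ps G) + (c + 2 * pbin_exp ps (fun k => `|w k|)).
  apply: le_trans (h1 _ _) _ => [k|k|]; rewrite ?eqxx ?orbT//.
  by rewrite le_eqVlt; apply/orP; left; apply/eqP; field; rewrite gt_eqF.
have h2 : 0 <= sg * pbin_exp ps G + (c + 2).
  by move: h1 pbin_exp_absw; rewrite mulrDr; lra.
have -> : pbin_exp ps G + (c + 2) / sg = (sg * pbin_exp ps G + (c + 2)) / sg.
  by field; rewrite gt_eqF.
by rewrite divr_ge0// ltW.
Qed.

Let wS k : w k.+1 - w k = sg^-1.
Proof. by rewrite /w -natr1; field; rewrite gt_eqF. Qed.

Let w_le k y : (w k <= (y - mu) / sg) = (k%:R <= y).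
Proof. by rewrite /w ler_pM2r ?invr_gt0// lerD2r. Qed.

Let w_between k i : (i == k) || (i == k.+1) -> w k <= w i <= w k.+1.
Proof.
have wk : w k <= w k.+1 by rewrite -subr_ge0 wS invr_ge0 ltW.
by move=> /orP[] /eqP ->; rewrite lexx wk.
Qed.

(** For comparisons with natural numbers, y behaves like an integer, so that each
step of the standardized lattice is on one side of z. *)
Section lattice_point.
Variables (y : R) (yZ : forall k : nat, k%:R < y -> k.+1%:R <= y).
Let z := (y - mu) / sg.

(** On the step from k < y to k + 1 the indicator is 1 at both ends because y is an
integer, and on the other steps it is only needed that it is nonnegative. *)
Lemma Phi_le_pbin_cdf : Phi z <= pbin_exp ps (fun k => (k%:R <= y)%R%:R) + (c + 2) / sg.
Proof.
have := @stein_ineq (fun k => stein z (w k)) (fun k => (k%:R <= y)%R%:R - Phi z).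
rewrite pbin_expD pbin_exp_cst => H; rewrite -subr_ge0 addrAC H// => k i ki.
have wi := w_between ki; have d0 : 0 <= sg^-1 by rewrite invr_ge0 ltW.
have [yk|/[dup] ky /yZ ky1] := leP y k%:R.
  have zk : z <= w k by rewrite /w /z ler_pM2r ?invr_gt0// lerD2r.
  have := stein_incrementR wi zk; rewrite wS ler_norml => /andP[_].
  by have := mulr_ge0 d0 (ler0n R (i%:R <= y)%R); lra.
have kz : w k.+1 <= z by rewrite w_le.
have -> : i%:R <= y by move: ki => /orP[] /eqP -> //; exact: ltW.
by have := stein_incrementL wi kz; rewrite wS ler_norml => /andP[_] /=; lra.
Qed.

(** As for the previous bound, with the opposite of the Stein solution; here the
strict inequality makes the indicator 0 at both ends of the steps beyond y. *)
Lemma pbin_cdf_le_Phi : pbin_exp ps (fun k => (k%:R < y)%R%:R) <= Phi z + (c + 2) / sg.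
Proof.
have := @stein_ineq (fun k => - stein z (w k)) (fun k => Phi z + -1 * (k%:R < y)%R%:R).
rewrite pbin_expD pbin_exp_cst pbin_expZ mulN1r => H; rewrite -subr_ge0 addrAC H// => k i ki.
have wi := w_between ki; have d0 : 0 <= sg^-1 by rewrite invr_ge0 ltW.
have [yk|/[dup] ky /yZ ky1] := leP y k%:R.
  have zk : z <= w k by rewrite /w /z ler_pM2r ?invr_gt0// lerD2r.
  have -> : (i%:R < y) = false.
    apply/negbTE; rewrite -leNgt (le_trans yk)// ler_nat.
    by move: ki => /orP[] /eqP ->.
  by have := stein_incrementR wi zk; rewrite wS ler_norml => /andP[+ _] /=; lra.
have kz : w k.+1 <= z by rewrite w_le.
have := stein_incrementL wi kz; rewrite wS ler_norml => /andP[+ _].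
have : 0 <= sg^-1 * (1 - (i%:R < y)%R%:R) by rewrite mulr_ge0// subr_ge0 lern1 leq_b1.
by lra.
Qed.

End lattice_point.

Let Phi_lip (x1 x2 : R) : x1 <= x2 -> Phi x2 - Phi x1 <= x2 - x1.
Proof.
move=> x12; have [x _ ->] := MVT_is_derive x12 (fun x _ => is_derive_Phi x).
by rewrite ler_piMl ?subr_ge0// phi_le1.
Qed.

Let floor_int (j : int) (k : nat) : k%:R < j%:~R :> R -> k.+1%:R <= j%:~R :> R.
Proof.
by rewrite -[k%:R]/(k%:Z%:~R) -[k.+1%:R]/(k.+1%:Z%:~R) ltr_int ler_int intS addrC lezD1.
Qed.

(** P(W <= x) only depends on the integer part j of mu + sigma x, and equals both
P(S <= j) and P(S < j + 1); the two lattice points around x are at distance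
1 / sigma, and Phi is 1-Lipschitz. *)
Theorem berry_esseen (x : R) :
  `|pbin_exp ps (fun k => (w k <= x)%R%:R) - Phi x| <= (c + 3) / sg.
Proof.
pose t := mu + sg * x; pose j : int := Num.floor t.
have xE : x = (t - mu) / sg by rewrite /t; field; rewrite gt_eqF.
have jt : j%:~R <= t by exact: floor_le.
have tj : t < (j + 1)%:~R by exact: floorD1_gt.
have wt k : (w k <= x) = (k%:R <= t) by rewrite {1}xE w_le.
have wj k : (k%:R <= t) = (k%:R <= j%:~R :> R).
  apply/idP/idP => [kt|kj]; last exact: le_trans jt.
  by rewrite -[k%:R]/(k%:Z%:~R) ler_int -ltzD1 -(ltr_int R) (le_lt_trans kt).
have wj1 k : (k%:R <= t) = (k%:R < (j + 1)%:~R :> R).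
  by rewrite wj -[k%:R]/(k%:Z%:~R) ler_int ltr_int ltzD1.
have h1 := Phi_le_pbin_cdf (@floor_int j).
have h2 := pbin_cdf_le_Phi (@floor_int (j + 1)).
have e1 : pbin_exp ps (fun k => (w k <= x)%R%:R) = pbin_exp ps (fun k => (k%:R <= j%:~R :> R)%R%:R).
  by apply: eq_pbin_exp => k; rewrite wt wj.
have e2 : pbin_exp ps (fun k => (w k <= x)%R%:R) = pbin_exp ps (fun k => (k%:R < (j + 1)%:~R :> R)%R%:R).
  by apply: eq_pbin_exp => k; rewrite wt wj1.
have z1 : (j%:~R - mu) / sg <= x by rewrite xE ler_pM2r ?invr_gt0// lerD2r.
have z2 : x <= ((j + 1)%:~R - mu) / sg.
  by rewrite xE ler_pM2r ?invr_gt0// lerD2r ltW.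
have l1 := Phi_lip z1; have l2 := Phi_lip z2.
have z12 : ((j + 1)%:~R - mu) / sg - (j%:~R - mu) / sg = sg^-1.
  by rewrite intrD; field; rewrite gt_eqF.
rewrite -e1 in h1; rewrite -e2 in h2.
rewrite ler_norml; apply/andP; split; move: h1 h2 l1 l2 z1 z2 z12; rewrite !(mulrDl c); lra.
Qed.

End BerryEsseen.

End PoissonBinomial.

(** * Linear growth of the variance *)

Section Growth.
Variable R : realType.

Lemma eventually_ge (y : R) : exists N : nat, forall n, (N <= n)%N -> y <= n%:R.
Proof.
exists (Num.trunc y).+1 => n Nn.
rewrite (le_trans (ltW (truncnS_gt y)))// ler_nat//.
Qed.

Variables (sg s q t0 : R) (e V : nat -> R).
Hypotheses (s0 : 0 < s) (q0 : 0 < q) (qsg : q < sg) (t00 : 0 < t0).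
Let t (n : nat) := t0 + s * n%:R.
Hypothesis e_rec : forall n, e n.+1 = e n * (1 - sg / t n) + q.
Hypothesis V_rec : forall n, V n.+1 = V n * (1 - 2 * sg / t n) +
  sg ^+ 2 * (e n / t n * (1 - e n / t n)).

Let t_gt0 n : 0 < t n.
Proof. by rewrite ltr_wpDr// mulr_ge0// ltW. Qed.

Let tS n : t n.+1 = t n + s.
Proof. by rewrite /t -natr1; ring. Qed.

Let t_eventually (y : R) : exists N : nat, forall n, (N <= n)%N -> y <= t n.
Proof.
have [N HN] := eventually_ge (y / s); exists N => n /HN.
by rewrite ler_pdivrMr// mulrC /t; move: t00; lra.
Qed.

Let sg0 : 0 < sg. Proof. exact: lt_trans qsg. Qed.

(** The deviation e n - pi * t n is multiplied by 1 - sg / t n at each step, so it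
is eventually nonincreasing in absolute value, while t n tends to infinity. *)
Lemma proportion_cvg (pi := q / (sg + s)) (eta : R) : 0 < eta ->
  exists N : nat, forall n, (N <= n)%N -> `|e n / t n - pi| <= eta.
Proof.
move=> eta0; have [N HN] := t_eventually sg.
pose dd n := e n - pi * t n.
have ss0 : sg + s != 0 by rewrite gt_eqF// addr_gt0.
have ddS n : dd n.+1 = dd n * (1 - sg / t n).
  by rewrite /dd e_rec tS /pi; field; rewrite ss0 gt_eqF.
have ddN n : (N <= n)%N -> `|dd n| <= `|dd N|.
  elim: n => [|n IH]; first by rewrite leqn0 => /eqP ->.
  rewrite leq_eqVlt => /orP[/eqP->//|]; rewrite ltnS => Nn.
  rewrite (le_trans _ (IH Nn))// ddS normrM ler_piMr// ger0_norm.
    by rewrite gerBl divr_ge0// ltW.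
  by rewrite subr_ge0 ler_pdivrMr// mul1r HN.
have [M HM] := t_eventually (`|dd N| / eta); exists (maxn N M) => n.
rewrite geq_max => /andP[/ddN nN /HM nM].
have -> : e n / t n - pi = dd n / t n by rewrite /dd; field; rewrite gt_eqF.
rewrite normrM normfV (gtr0_norm (t_gt0 n)) ler_pdivrMr//.
by apply: le_trans nN _; rewrite -ler_pdivrMl// mulrC.
Qed.

(** Once e n / t n is close to its limit pi, the source term of the recurrence is at
least some delta > 0.  The linear function kappa * t n with
kappa (s + 2 sg) = delta solves the recurrence with that source exactly, so the
difference V n - kappa * t n satisfies the homogeneous inequality and stays
bounded below. *)
Lemma variance_growth : exists2 kappa : R, 0 < kappa &
  exists N : nat, forall n, (N <= n)%N -> kappa * n%:R <= V n.
Proof.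
pose pi := q / (sg + s); pose v := pi * (1 - pi).
have pi0 : 0 < pi by rewrite divr_gt0 ?addr_gt0.
have pi1 : pi < 1 by rewrite ltr_pdivrMr ?addr_gt0// mul1r; move: qsg s0; lra.
have v0 : 0 < v by rewrite mulr_gt0// subr_gt0.
have v1 : v <= 1 by rewrite mulr_ile1//; [exact: ltW|rewrite subr_ge0 ltW|exact: ltW|rewrite gerBl ltW].
have v40 : 0 < v / 4 by rewrite divr_gt0.
have [N1 HN1] := proportion_cvg v40.
have [N2 HN2] := t_eventually (2 * sg).
pose N := maxn N1 N2; pose delta := sg ^+ 2 * (v / 2).
pose kappa := delta / (s + 2 * sg).
have delta0 : 0 < delta by rewrite mulr_gt0 ?exprn_gt0 ?divr_gt0.
have kappa0 : 0 < kappa by rewrite divr_gt0// addr_gt0// mulr_gt0.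
have pq n : (N <= n)%N -> v / 2 <= e n / t n * (1 - e n / t n).
  rewrite geq_max => /andP[/HN1 + _].
  rewrite -/pi; set r := e n / t n; set y := r - pi => hy.
  have -> : r = pi + y by rewrite /y; ring.
  move: hy; rewrite ler_norml => /andP[hy1 hy2].
  have -> : (pi + y) * (1 - (pi + y)) = v + y * (1 - 2 * pi) - y * y by rewrite /v; ring.
  have h1 : `|y * (1 - 2 * pi)| <= v / 4.
    rewrite normrM -[leRHS]mulr1 ler_pM//; first by rewrite ler_norml hy1.
    by rewrite ler_norml; apply/andP; split; move: pi0 pi1; lra.
  have h2 : y * y <= v / 4.
    apply: le_trans (_ : v / 4 * 1 <= _); last by rewrite mulr1.
    rewrite (le_trans (ler_norm _))// normrM ler_pM// ler_norml; first by rewrite hy1.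
    by apply/andP; split; move: hy1 hy2 v1; lra.
  by move: h1; rewrite ler_norml => /andP[h1 _]; move: h1 h2 v0; lra.
pose u n := V n - kappa * t n.
have uS n : (N <= n)%N -> (1 - 2 * sg / t n) * u n <= u n.+1.
  move=> Nn; rewrite /u V_rec tS.
  have := ler_wpM2l (ltW (exprn_gt0 2 sg0)) (pq n Nn); rewrite -/delta.
  have kE : kappa * s + 2 * sg * kappa = delta.
    by rewrite /kappa; field; rewrite gt_eqF// addr_gt0// mulr_gt0.
  have tE : 2 * sg / t n * (kappa * t n) = 2 * sg * kappa by field; rewrite gt_eqF.
  rewrite (mulrBr (1 - _)) !(mulrBl _ 1) !mul1r tE -kE (mulrC (V n)) mulrBl mul1r; lra.
have uN n : (N <= n)%N -> - `|u N| <= u n.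
  elim: n => [|n IH]; first by rewrite leqn0 => /eqP <-; rewrite lerNl -normrN ler_norm.
  rewrite leq_eqVlt => /orP[/eqP<-|]; first by rewrite lerNl -normrN ler_norm.
  rewrite ltnS => Nn; apply: le_trans (uS n Nn).
  have c0 : 0 <= 1 - 2 * sg / t n.
    by rewrite subr_ge0 ler_pdivrMr// mul1r HN2// (leq_trans _ Nn)// leq_maxr.
  have c1 : 1 - 2 * sg / t n <= 1 by rewrite gerBl divr_ge0 ?mulr_ge0// ltW.
  apply: le_trans (ler_wpM2l c0 (IH Nn)).
  by rewrite mulrN lerN2 ler_piMl.
have [M HM] := eventually_ge (2 * `|u N| / (kappa * s)).
exists (kappa * s / 2); first by rewrite divr_gt0// mulr_gt0.
exists (maxn N M) => n; rewrite geq_max => /andP[/uN h1 /HM].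
rewrite (ler_pdivrMr _ _ (mulr_gt0 kappa0 s0)) => h2.
have : V n = u n + kappa * t n by rewrite /u subrK.
rewrite /t; have := mulr_gt0 kappa0 t00; move: h1 h2; lra.
Qed.

End Growth.

(** * The law of the number of second-color draws *)

Section FiniteValued.
Context d (T : measurableType d) (R : realType) (P : probability T R).
Context (I : finType) (Z : T -> I).
Hypothesis mZ : forall i, measurable [set w | Z w = i].

Lemma total_probability (A : set T) : measurable A ->
  fine (P A) = \sum_i fine (P (A `&` [set w | Z w = i])).
Proof.
move=> mA; have mAi i : measurable (A `&` [set w | Z w = i]) by exact: measurableI.
suff -> : P A = (\sum_i P (A `&` [set w | Z w = i]))%E.
  by rewrite -sum_fine// => i _; exact: fin_num_measure.
transitivity (\int[P]_w (\sum_(i : I) (\1_(A `&` [set w | Z w = i]) w)%:E))%E.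
  rewrite -[in LHS](setIT A) -integral_indic//; apply: eq_integral => w _.
  rewrite (bigD1 (Z w))//= big1 ?adde0; last first.
    move=> i iw; rewrite indicE memNset//= => -[_ e].
    by rewrite e eqxx in iw.
  rewrite !indicE in_setI [X in _ && X]mem_set ?andbT//.
rewrite integral_sum//=; last first.
  by move=> i; apply: integrable_indic => //; rewrite ltey_eq fin_num_measure.
by apply: eq_bigr => i _; rewrite integral_indic// setIT.
Qed.

Lemma finite_expectation (f : I -> R) :
  ('E_P[fun w => f (Z w)])%E = (\sum_i fine (P [set w | Z w = i]) * f i)%:E.
Proof.
rewrite unlock -sumEFin.
transitivity (\int[P]_w (\sum_(i : I) (f i)%:E * (\1_([set w | Z w = i]) w)%:E))%E.
  apply: eq_integral => w _.
  rewrite (bigD1 (Z w))//= big1 ?adde0; last first.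
    move=> i iw; rewrite indicE memNset ?mule0//= => e.
    by rewrite e eqxx in iw.
  by rewrite indicE mem_set// mule1.
have ii i : P.-integrable setT (fun w => (\1_([set w | Z w = i]) w)%:E).
  by apply: integrable_indic => //; rewrite ltey_eq fin_num_measure.
rewrite integral_sum//=; last by move=> i; exact: integrableZl.
apply: eq_bigr => i _; rewrite integralZl// integral_indic// setIT.
by rewrite mulrC EFinM fineK ?fin_num_measure.
Qed.

End FiniteValued.

Section UrnLaw.
Context (R : realType) d (T : measurableType d) (P : probability T R).
Variables (a b s a0 b0 : nat).
Hypothesis (a_gt0 : (0 < a)%N) (s_gt0 : (0 < s)%N) (ab0_gt0 : (0 < a0 + b0)%N).
Variable D : nat -> {RV P >-> bool}.
Hypothesis urnD : urn_draws a b s a0 b0 D.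

(** sg is the difference between the two possible increments of the first color;
t n and x n k are the total number of balls and the number of balls of the first
color at time n, when k of the n draws gave the second color. *)
Let sg : R := (a + b + s)%:R.
Let t (n : nat) : R := (a0 + b0 + s * n)%:R.
Let x (n k : nat) : R := a0%:R - (a * n)%:R + sg * k%:R.
Let nsecond (h : seq bool) := count negb h.

Let t_gt0 n : 0 < t n.
Proof. by rewrite ltr0n addn_gt0 ab0_gt0. Qed.

(** The composition depends on the history only through its length and the number
of draws of the second color. *)
Lemma urn_afterE (h : seq bool) :
  urn_after a b s a0 b0 h =
  (a0%:Z - (a * size h)%:Z + ((a + b + s) * nsecond h)%:Z,
   b0%:Z + ((a + s) * size h)%:Z - ((a + b + s) * nsecond h)%:Z).
Proof.
rewrite /urn_after; move: (a0%:Z) (b0%:Z) => z1 z2.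
elim: h z1 z2 => [|[] h IH] z1 z2 /=.
- by congr (_, _); lia.
- by rewrite IH add0n; congr (_, _); lia.
- by rewrite IH add1n; congr (_, _); lia.
Qed.

Lemma urn_ratioE (h : seq bool) (z := urn_after a b s a0 b0 h) :
  z.1%:~R / (z.1 + z.2)%:~R = x (size h) (nsecond h) / t (size h).
Proof.
rewrite /z urn_afterE /=; congr (_ / _).
  by rewrite /x /sg -natrM intrD intrB.
rewrite /t -[_%:R]/(_%:Z%:~R); congr (_%:~R); lia.
Qed.

Lemma measurable_past n h : measurable [set w | past_draws D n w = h].
Proof.
rewrite /past_draws; elim: n h => [|n IH] h.
  case: h => [|c h]; first by rewrite (_ : [set _ | _] = setT)//; exact/seteqP.
  by rewrite (_ : [set _ | _] = set0)//; apply/seteqP; split.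
rewrite (_ : [set _ | _] = [set w | rcons (mkseq (D^~ w) n) (D n w) = h]); last first.
  by apply/funext => w; rewrite /mkset mkseqS.
case/lastP: h => [|h c].
  rewrite (_ : [set _ | _] = set0)//; apply/seteqP; split => // w.
  by move=> /(congr1 size); rewrite size_rcons.
rewrite (_ : [set _ | _] = [set w | mkseq (D^~ w) n = h] `&` (D n @^-1` [set c])).
  by apply: measurableI => //; exact: measurable_funPTI.
by apply/seteqP; split => w /= => [/rcons_inj[]|[-> ->]].
Qed.

Lemma measurable_draw n c : measurable [set w | D n w = c].
Proof. exact: (@measurable_funPTI _ _ _ _ (D n) [set c]). Qed.

Let C n w := nsecond (past_draws D n w).
Let past n w : n.-tuple bool := [tuple of past_draws D n w].

Let draw_true n h : fine (P ([set w | past_draws D n w = h] `&` [set w | D n w = true])) =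
  fine (P [set w | past_draws D n w = h]) * (x (size h) (nsecond h) / t (size h)).
Proof.
have /= := urnD n h; rewrite urn_ratioE => /(congr1 fine).
by rewrite fineM ?fin_num_measure//; exact: measurable_past.
Qed.

(** The rule for the second color, by complement. *)
Let draw_false n h : fine (P ([set w | past_draws D n w = h] `&` [set w | D n w = false])) =
  fine (P [set w | past_draws D n w = h]) * (1 - x (size h) (nsecond h) / t (size h)).
Proof.
rewrite mulrBr mulr1 -draw_true.
rewrite [in RHS](total_probability P (Z := D n) (measurable_draw n)); last first.
  exact: measurable_past.
by rewrite big_bool /= addrC addrK.
Qed.

Let draw_ratio n k c : R := if c then x n k / t n else 1 - x n k / t n.

Lemma measurable_pastT n (h : n.-tuple bool) : measurable [set w | past n w = h].
Proof.
rewrite (_ : [set _ | _] = [set w | past_draws D n w = h]); first exact: measurable_past.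
by apply/seteqP; split => w /= => [<-//|e]; apply: val_inj.
Qed.

Lemma measurable_count n k : measurable [set w | C n w = k].
Proof.
rewrite (_ : [set _ | _] =
  \bigcup_(h in [set h : n.-tuple bool | nsecond h = k]) [set w | past n w = h]).
  apply: fin_bigcup_measurable => [|h _]; first exact: finite_finset.
  exact: measurable_pastT.
apply/seteqP; split => [w /= e|w [h /= hk ph]]; first by exists (past n w).
by rewrite /C -hk -ph.
Qed.

(** Sum over the histories with k draws of the second color, on which the
conditional probability of the next color is constant. *)
Lemma prob_count_draw n k c :
  fine (P ([set w | C n w = k] `&` [set w | D n w = c])) =
  fine (P [set w | C n w = k]) * draw_ratio n k c.
Proof.
rewrite (total_probability P (@measurable_pastT n)); last first.
  by apply: measurableI; [exact: measurable_count|exact: measurable_draw].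
rewrite [in RHS](total_probability P (@measurable_pastT n)) ?mulr_suml; last first.
  exact: measurable_count.
apply: eq_bigr => h _.
have pE : [set w | past n w = h] = [set w | past_draws D n w = h].
  by apply/seteqP; split => w /= => [<-//|e]; apply: val_inj.
have [hk|hk] := eqVneq (nsecond h) k; last first.
  rewrite (_ : _ `&` _ `&` _ = set0); last first.
    apply/seteqP; split => // w /= [[e _] eh].
    by move: hk; rewrite -e /C -eh eqxx.
  rewrite (_ : _ `&` _ = set0); last first.
    by apply/seteqP; split => // w /= [e eh]; move: hk; rewrite -e /C -eh eqxx.
  by rewrite measure0 mul0r.
have CE : [set w | past_draws D n w = h] `<=` [set w | C n w = k].
  by move=> w /= e; rewrite /C e.
rewrite pE setIAC ((setIidPr _ _).2 CE) /draw_ratio -hk.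
have sz : size h = n by exact: size_tuple.
by case: c; rewrite ?draw_true ?draw_false sz.
Qed.

Definition count_law n k : R := fine (P [set w | C n w = k]).

Lemma count_law_rec n k : count_law n.+1 k =
  count_law n k * (x n k / t n) +
  (if k is k'.+1 then count_law n k' * (1 - x n k' / t n) else 0).
Proof.
have CS w : C n.+1 w = (C n w + ~~ D n w)%N.
  by rewrite /C /past_draws mkseqS /nsecond -cats1 count_cat /= addn0.
rewrite /count_law (total_probability P (measurable_draw n)); last exact: measurable_count.
rewrite big_bool /=.
have -> : [set w | C n.+1 w = k] `&` [set w | D n w = true] =
   [set w | C n w = k] `&` [set w | D n w = true].
  by apply/seteqP; split => w /= [+ e]; rewrite CS e addn0.
rewrite prob_count_draw; congr (_ + _).
case: k => [|k].
  rewrite (_ : _ `&` _ = set0) ?measure0//; apply/seteqP; split => w //= [+ e].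
  by rewrite CS e addn1.
rewrite -(prob_count_draw n k false); congr (fine (P _)).
by apply/seteqP; split => w /= [+ e]; rewrite CS e addn1; [case|move=> ->].
Qed.

(** The recurrence of the law is [urn_op] with c + be k the proportion of balls of
the first color; its coefficients are nonnegative because they are
probabilities. *)
Lemma count_law_poisson_binomial n :
  exists ps, all (@pos_prob R) ps /\ forall k, (pbin_poly ps)`_k = count_law n k.
Proof.
elim: n => [|n [ps [ps01 psE]]].
  exists [::]; split=> // k; rewrite /pbin_poly big_nil coef1 /count_law.
  case: k => [|k].
    by rewrite (_ : [set _ | _] = setT) ?probability_setT//; apply/seteqP; split.
  by rewrite (_ : [set _ | _] = set0) ?measure0//; apply/seteqP; split.
have E k : (urn_op (x n 0%N / t n) (sg / t n) (pbin_poly ps))`_k = count_law n.+1 k.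
  have r j : x n 0 / t n + sg / t n * j%:R = x n j / t n by rewrite /x; ring.
  rewrite urn_op_coef count_law_rec; case: k => [|k]; by rewrite !r !psE.
have be0 : 0 < sg / t n by rewrite divr_gt0// ltr0n !addn_gt0 a_gt0.
have [|ps' ps'01 ps'E] := @urn_op_pbin_poly R (x n 0%N / t n) _ _ be0 ps01.
  by move=> k; rewrite E fine_ge0.
by exists ps'; split=> // k; rewrite -ps'E.
Qed.

Section Moments.
Variable ps : nat -> seq R.
Hypothesis ps01 : forall n, all (@pos_prob R) (ps n).
Hypothesis psE : forall n k, (pbin_poly (ps n))`_k = count_law n k.
Let r n k : R := x n k / t n.

Lemma count_le n w : (C n w <= n)%N.
Proof. by rewrite /C /nsecond (leq_trans (count_size _ _))// size_mkseq. Qed.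

Lemma count_expectation n (f : nat -> R) :
  ('E_P[fun w => f (C n w)])%E = (pbin_exp (ps n) f)%:E.
Proof.
(* M bounds both the values of the count and the degree of its generating
   polynomial. *)
pose M := maxn n (size (ps n)).
pose Z w : 'I_M.+1 := inord (C n w).
have ZE w : Z w = C n w :> nat.
  by rewrite inordK// ltnS (leq_trans (count_le n w))// leq_maxl.
have mE (i : 'I_M.+1) : [set w | Z w = i] = [set w | C n w = i].
  by apply/seteqP; split => w /= => [<-|e]; [rewrite ZE|apply: val_inj; rewrite /= ZE].
have mZ i : measurable [set w | Z w = i] by rewrite mE; exact: measurable_count.
rewrite (_ : (fun w => f (C n w)) = (fun w => (f \o val) (Z w))); last first.
  by apply/funext => w /=; rewrite ZE.
rewrite finite_expectation// (@pbin_exp_poly _ _ _ M.+1) ?ltnS ?leq_maxr//.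
by congr (_%:E); apply: eq_bigr => i _; rewrite mE psE.
Qed.

Lemma measurable_count_pred n (p : pred nat) : measurable [set w | p (C n w)].
Proof.
rewrite (_ : [set _ | _] = \bigcup_(k in [set k | p k]) [set w | C n w = k]).
  by apply: bigcup_measurable => k _; exact: measurable_count.
apply/seteqP; split => [w /= e|w [k /= pk Ck]]; first by exists (C n w).
by rewrite Ck.
Qed.

Lemma count_prob n (p : pred nat) :
  fine (P [set w | p (C n w)]) = pbin_exp (ps n) (fun k => (p k)%:R).
Proof.
have := count_expectation n (fun k => (p k)%:R).
rewrite (_ : (fun w => _) = \1_[set w | p (C n w)]); last first.
  apply/funext => w; rewrite indicE; congr (_%:R); case: (boolP (p _)) => h.
    by rewrite mem_set.
  by rewrite memNset//=; exact/negP.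
by rewrite expectation_indic => [->//|]; exact: measurable_count_pred.
Qed.

Lemma pbin_exp_step n F : pbin_exp (ps n.+1) F =
  pbin_exp (ps n) (fun k => r n k * F k + (1 - r n k) * F k.+1).
Proof.
pose M := maxn (size (ps n)) (size (ps n.+1)).
have M1 : (size (ps n) <= M)%N by rewrite leq_maxl.
have M2 : (size (ps n.+1) <= M)%N by rewrite leq_maxr.
rewrite pbin_expD !(@pbin_exp_poly _ _ _ M.+2) ?ltnS ?leqW//.
rewrite [X in _ = _ + X](_ : _ = pbin_exp (ps n) (fun k => (1 - r n k) * F k.+1)); last first.
  by rewrite (@pbin_exp_poly _ _ _ M.+2) ?ltnS ?leqW.
rewrite (@pbin_exp_poly _ _ (fun k => (1 - r n k) * F k.+1) M.+1) ?ltnS//.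
under eq_bigr do rewrite psE count_law_rec mulrDl.
rewrite big_split /=; congr (_ + _).
  by apply: eq_bigr => k _; rewrite psE [RHS]mulrA.
rewrite big_ord_recl /= mul0r add0r; apply: eq_bigr => k _.
by rewrite psE [RHS]mulrA.
Qed.

Let e n : R := pbin_exp (ps n) (x n).
Let V n : R := sg ^+ 2 * pbin_var (ps n).

Let x_mean n k : x n k - e n = sg * (k%:R - pbin_mean (ps n)).
Proof.
rewrite /e (_ : pbin_exp _ _ = pbin_exp (ps n) (fun k => (a0%:R - (a * n)%:R) + sg * k%:R))//.
by rewrite pbin_expD pbin_exp_cst pbin_expZ pbin_exp_mean /x; ring.
Qed.

Let VE n : V n = pbin_exp (ps n) (fun k => (x n k - e n) ^+ 2).
Proof.
rewrite /V -pbin_exp_variance// -pbin_expZ; apply: eq_pbin_exp => k.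
by rewrite x_mean exprMn.
Qed.

Let x_Sn n k : x n.+1 k = x n k - a%:R.
Proof. by rewrite /x mulnS natrD; ring. Qed.

Let x_SS n k : x n.+1 k.+1 = x n k + (b + s)%:R.
Proof. by rewrite x_Sn /x -natr1 /sg !natrD; ring. Qed.

Let e_rec n : e n.+1 = e n * (1 - sg / t n) + (b + s)%:R.
Proof.
rewrite {1}/e pbin_exp_step.
rewrite (_ : pbin_exp _ _ = pbin_exp (ps n) (fun k => (1 - sg / t n) * x n k + (b + s)%:R)).
  by rewrite pbin_expD pbin_expZ pbin_exp_cst mulrC.
have tn0 : t n != 0 by rewrite gt_eqF.
apply: eq_pbin_exp => k; rewrite x_Sn x_SS /r natrD.
have -> : a%:R = sg - b%:R - s%:R by rewrite /sg !natrD; ring.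
by move: (t n) tn0 (x n k) sg => tn tn0 y g; field.
Qed.

(** Given that k second-color draws have occurred, centering at e n and expanding
leaves the factor 1 - 2 sg / t n on the square, a term linear in x n k - e n,
whose mean is 0, and a constant. *)
Let V_rec n : V n.+1 = V n * (1 - 2 * sg / t n) +
  sg ^+ 2 * (e n / t n * (1 - e n / t n)).
Proof.
have tn0 : t n != 0 by rewrite gt_eqF.
have sgE : sg = a%:R + b%:R + s%:R by rewrite /sg !natrD.
rewrite [LHS]VE pbin_exp_step.
rewrite (_ : pbin_exp _ _ = pbin_exp (ps n) (fun k => (1 - 2 * sg / t n) * (x n k - e n) ^+ 2 +
   ((sg ^+ 2 * (1 - 2 * (e n / t n)) / t n) * (x n k - e n) +
    sg ^+ 2 * (e n / t n * (1 - e n / t n))))).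
  rewrite !pbin_expD !pbin_expZ pbin_exp_cst -VE mulrC; congr (_ + _).
  rewrite (_ : pbin_exp (ps n) (fun k => x n k - e n) = 0) ?mulr0 ?add0r//.
  by rewrite pbin_expD pbin_exp_cst subrr.
apply: eq_pbin_exp => k; rewrite x_Sn x_SS e_rec /r natrD.
have -> : a%:R = sg - b%:R - s%:R by rewrite sgE; ring.
clear sgE; move: (t n) tn0 (x n k) (e n) sg => tn tn0 y m g; field.
done.
Qed.

Lemma count_variance_growth : exists2 kappa : R, 0 < kappa &
  exists N : nat, forall n, (N <= n)%N -> kappa * n%:R <= sg ^+ 2 * pbin_var (ps n).
Proof.
have tE n : t n = (a0 + b0)%:R + s%:R * n%:R by rewrite /t natrD natrM.
apply: (@variance_growth R sg s%:R (b + s)%:R (a0 + b0)%:R e V).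
- by rewrite ltr0n.
- by rewrite ltr0n addn_gt0 s_gt0 orbT.
- by rewrite ltr_nat -addnA -[ltnLHS]add0n ltn_add2r.
- by rewrite ltr0n.
- by move=> n; rewrite -tE; exact: e_rec.
- by move=> n; rewrite -tE; exact: V_rec.
Qed.

Let X n w : R := first_color R a b s a0 b0 D n w.

Let XE n : X n = fun w => x n (C n w).
Proof.
apply/funext => w; rewrite /X /first_color urn_afterE /= size_mkseq.
by rewrite intrD intrB /x /sg -natrM.
Qed.

Let expectation_X n : fine ('E_P[X n])%E = e n.
Proof. by rewrite XE count_expectation. Qed.

Let variance_X n : fine ('V_P[X n])%E = V n.
Proof.
rewrite /variance unlock VE expectation_X.
rewrite (_ : (_ * _) = (fun w => (x n (C n w) - e n) ^+ 2)); last first.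
  by apply/funext => w; rewrite XE expr2.
by rewrite (count_expectation n (fun k => (x n k - e n) ^+ 2)).
Qed.

(** Since X n = x n (C n) is an increasing affine function of C n, both have the
same standardization. *)
Lemma urn_berry_esseen : exists C0 : R, \forall n \near \oo, forall y : R,
  `| fine (P [set w | (X n w - fine ('E_P[X n])%E) / Num.sqrt (fine ('V_P[X n])%E) <= y])
     - Phi y | <= C0 / Num.sqrt n%:R.
Proof.
have [kappa kappa0 [N HN]] := count_variance_growth.
have sg0 : 0 < sg by rewrite ltr0n !addn_gt0 a_gt0.
exists ((millsC R + 3) * sg / Num.sqrt kappa).
near=> n => y.
have n0 : (0 < n)%N by near: n; exact: nbhs_infty_gt.
have kn : kappa * n%:R <= V n by apply: HN; near: n; exact: nbhs_infty_ge.
have kn0 : 0 < kappa * n%:R by rewrite mulr_gt0// ltr0n.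
have v0 : 0 < pbin_var (ps n).
  by have := lt_le_trans kn0 kn; rewrite pmulr_rgt0// exprn_gt0.
have sqV : Num.sqrt (V n) = sg * Num.sqrt (pbin_var (ps n)).
  by rewrite /V sqrtrM ?sqr_ge0// sqrtr_sqr gtr0_norm.
have sv0 : 0 < Num.sqrt (pbin_var (ps n)) by rewrite sqrtr_gt0.
rewrite expectation_X variance_X sqV XE.
rewrite (_ : [set w | _] = [set w | (((C n w)%:R - pbin_mean (ps n)) / Num.sqrt (pbin_var (ps n)) <= y)%R]);
  last first.
  apply/funext => w; rewrite /mkset x_mean; congr (is_true (_ <= _)).
  by rewrite invfM mulrACA divff ?mul1r// gt_eqF.
rewrite (count_prob n (fun k => ((k%:R - pbin_mean (ps n)) / Num.sqrt (pbin_var (ps n)) <= y)%R)).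
apply: le_trans (berry_esseen (ps01 n) v0 y) _.
have c0 : 0 <= millsC R + 3 by rewrite addr_ge0// (le_trans _ (millsC_ge1 R)).
rewrite -[leRHS]mulrA -[leRHS]mulrA ler_wpM2l//.
rewrite -invfM -sqrtrM ?(ltW kappa0)// -[leLHS]mul1r ler_pdivrMr//.
rewrite mulrAC -sqV ler_pdivlMr ?sqrtr_gt0// mul1r ler_wsqrtr//.
Unshelve. all: by end_near. Qed.

End Moments.

End UrnLaw.

Theorem corollary2 (R : realType) (d : measure_display) (T : measurableType d)
    (P : probability T R) (a b s a0 b0 : nat)
    (a_gt0 : (0 < a)%N) (b_gt0 : (0 < b)%N) (s_gt0 : (0 < s)%N)
    (ab0_gt0 : (1 <= a0 + b0)%N) (tnb : tenable a b s a0 b0)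
    (D : nat -> {RV P >-> bool}) (urnD : urn_draws a b s a0 b0 D) :
  let X : nat -> T -> R := first_color R a b s a0 b0 D in
  exists C : R, \forall n \near \oo, forall x : R,
    `| fine (P [set w | (X n w - fine 'E_P[X n]) /
                         Num.sqrt (fine 'V_P[X n]) <= x])
       - (Num.sqrt (2 * pi))^-1 *
           \int[lebesgue_measure]_(y in `]-oo, x]) expR (- (y ^+ 2 / 2)) |
    <= C / Num.sqrt n%:R.
Proof.
have [ps psP] := choice (count_law_poisson_binomial a_gt0 s_gt0 ab0_gt0 urnD).
exact: (urn_berry_esseen a_gt0 s_gt0 ab0_gt0 urnD
  (fun n => (psP n).1) (fun n => (psP n).2)).
Qed.
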